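(* Let $G$ be a finitely generated nilpotent group, and let $i,k>0$ be integers. Then $$\mathcal{V}_k^i(G)=\begin{cases}\{1\}, & \text{if } b_i(G)\ge k;\\ \emptyset, & \text{otherwise.}\end{cases}$$
   Context: For a finitely generated group $G$, let $\mathbb{T}_G=\operatorname{Hom}(G,\mathbb{C}^* )$ be its character torus (group of characters), with trivial character denoted $1$. For $\rho\in\mathbb{T}_G$, $\mathbb{C}_\rho$ denotes the $G$-module $\mathbb{C}$ with $G$ acting through $\rho$. For integers $i,k>0$ the characteristic varieties of $G$ are $$\mathcal{V}_k^i(G)=\{\rho\in\mathbb{T}_G \mid \dim_{\mathbb{C}} H^i(G,\mathbb{C}_\rho)\ge k\},$$ where $H^i(G,-)$ is group cohomology (cohomology of $K(G,1)$ with local coefficients). $b_i(G)=\dim_{\mathbb{C}}H^i(G,\mathbb{C})$ (trivial coefficients) is the $i$-th Betti number. *)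

(* Defs.v *)
From HB Require Import structures.
From mathcomp Require Import all_boot all_order all_algebra.
From mathcomp Require Import all_classical all_reals.
From mathcomp Require Import constructive_ereal ereal.
From mathcomp Require Import complex zify.

Set Implicit Arguments.
Unset Strict Implicit.
Unset Printing Implicit Defensive.

Import Order.TTheory GRing.Theory Num.Theory.
Local Open Scope classical_set_scope.
Local Open Scope ring_scope.

Section Groups.
Variable G : groupType.
Implicit Types A B H : set G.

Definition is_subgroup H : Prop :=
  [/\ H 1%g, forall x y, H x -> H y -> H (x * y)%g & forall x, H x -> H x^-1%g].

Definition subgroup_gen A : set G := smallest is_subgroup A.

Definition finitely_generated : Prop :=
  exists2 A : set G, finite_set A & subgroup_gen A = [set: G].

Definition commutator_subgroup A B : set G :=
  subgroup_gen [set [~ x, y]%g | x in A & y in B].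

Fixpoint lower_central_series (n : nat) : set G :=
  if n is m.+1 then commutator_subgroup (lower_central_series m) [set: G]
  else [set: G].

Definition nilpotent_group : Prop :=
  exists n, lower_central_series n = [set 1%g].

End Groups.

Arguments finitely_generated : clear implicits.
Arguments nilpotent_group : clear implicits.

(* The multiplicative group of a field; [{unit F}] is only available for
   finite rings. *)
Section MulGroup.
Variable F : fieldType.

Definition mul_group : Type := {x : F | x != 0}.

HB.instance Definition _ := Choice.on mul_group.
HB.instance Definition _ := SubType.on mul_group.

Definition mul_group_one : mul_group := exist _ 1 (oner_neq0 F).

Definition mul_group_mul (x y : mul_group) : mul_group :=
  exist _ (val x * val y) (mulf_neq0 (valP x) (valP y)).

Fact mul_group_inv_subproof (x : mul_group) : (val x)^-1 != 0.
Proof. by rewrite invr_eq0 (valP x). Qed.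

Definition mul_group_inv (x : mul_group) : mul_group :=
  exist _ (val x)^-1 (mul_group_inv_subproof x).

Fact mul_groupA : associative mul_group_mul.
Proof. by move=> x y z; apply: val_inj; rewrite /= mulrA. Qed.
Fact mul_group1g : left_id mul_group_one mul_group_mul.
Proof. by move=> x; apply: val_inj; rewrite /= mul1r. Qed.
Fact mul_groupg1 : right_id mul_group_one mul_group_mul.
Proof. by move=> x; apply: val_inj; rewrite /= mulr1. Qed.
Fact mul_groupVg : left_inverse mul_group_one mul_group_inv mul_group_mul.
Proof. by move=> x; apply: val_inj; rewrite /= mulVf ?(valP x). Qed.
Fact mul_groupgV : right_inverse mul_group_one mul_group_inv mul_group_mul.
Proof. by move=> x; apply: val_inj; rewrite /= mulfV ?(valP x). Qed.

HB.instance Definition _ := isGroup.Build mul_group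
  mul_groupA mul_group1g mul_groupg1 mul_groupVg mul_groupgV.

End MulGroup.

Section QuotientModule.
Variables (K : pzRingType) (V : lmodType K) (W : {pred V}).
Hypothesis W_submod : GRing.submod_closed W.

Definition submod_zmodClosed : zmodClosed V :=
  HB.pack_for (zmodClosed V) (W : V -> bool)
    (GRing.isZmodClosed.Build V W (GRing.submod_closedB W_submod)).

Definition lquot : Type := Quotient.quot submod_zmodClosed.

HB.instance Definition _ := GRing.Zmodule.on lquot.
HB.instance Definition _ := EqQuotient.on lquot.

Local Open Scope quotient_scope.

Definition lquot_scale (a : K) (u : lquot) : lquot :=
  \pi_lquot (a *: (repr u)).

Fact pi_scale (a : K) (v : V) :
  lquot_scale a (\pi_lquot v) = \pi_lquot (a *: v).
Proof.
apply/eqP; rewrite /lquot_scale -Quotient.idealrBE -scalerBr.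
apply: (GRing.subsemimod_closedZ (GRing.submod_closed_semi W_submod)).
have /eqP := reprK (\pi_lquot v).
by rewrite -(Quotient.idealrBE submod_zmodClosed).
Qed.

Fact pi_addq (u v : V) :
  \pi_lquot (u + v) = \pi_lquot u + \pi_lquot v :> lquot.
Proof. exact: (@Quotient.pi_add V submod_zmodClosed u v). Qed.

Fact lquot_scaleA a b u : lquot_scale a (lquot_scale b u) = lquot_scale (a * b) u.
Proof. by elim/quotW: u => v; rewrite [X in lquot_scale a X]pi_scale !pi_scale scalerA. Qed.
Fact lquot_scale1 : left_id 1 lquot_scale.
Proof. by elim/quotW=> v; rewrite pi_scale scale1r. Qed.
Fact lquot_scaleDr : right_distributive lquot_scale +%R.
Proof.
move=> a; elim/quotW=> u; elim/quotW=> v.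
by rewrite -pi_addq !pi_scale scalerDr pi_addq.
Qed.
Fact lquot_scaleDl u : {morph lquot_scale^~ u : a b / a + b}.
Proof. by move=> a b; elim/quotW: u => v; rewrite !pi_scale scalerDl pi_addq. Qed.

HB.instance Definition _ := GRing.Zmodule_isLmodule.Build K lquot
  lquot_scaleA lquot_scale1 lquot_scaleDr lquot_scaleDl.

End QuotientModule.

(* Possibly infinite dimension: the supremum of the lengths of linearly
   independent families, in the extended reals over [R]. *)
Section Dimension.
Variables (R : realType) (K : fieldType) (V : lmodType K).

Definition lin_indep (n : nat) (v : 'I_n -> V) : Prop :=
  forall c : 'I_n -> K, \sum_(j < n) c j *: v j = 0 -> forall j, c j = 0.

Definition dimension : \bar R :=
  ereal_sup [set (n%:R)%:E | n in [set n | exists v : 'I_n -> V, lin_indep v]].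

End Dimension.

(* Linear actions of [G] on a fixed [K]-vector space, i.e. [K[G]]-modules. *)
Record gmodule (G : groupType) (K : fieldType) (V : lmodType K) := GModule {
  gact :> G -> V -> V;
  gact_linear : forall g, linear (gact g);
  gact1 : forall v, gact 1%g v = v;
  gactM : forall g h v, gact (g * h)%g v = gact g (gact h v)
}.

(* [H^n(G, V)] is computed from the homogeneous bar resolution: an [n]-cochain
   is an equivariant function [G^(n+1) -> V]. *)
Section Cohomology.
Variables (G : groupType) (K : fieldType) (V : lmodType K) (M : gmodule G V).

Definition equivariant (n : nat) (f : ('I_n -> G) -> V) : Prop :=
  forall g x, f (fun j => g * x j)%g = M g (f x).

Definition cobord (n : nat) (f : ('I_n.+1 -> G) -> V) : ('I_n.+2 -> G) -> V :=
  fun x => \sum_(j < n.+2) (-1) ^+ j *: f (x \o lift j).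

Definition is_cocycle (n : nat) (f : ('I_n.+1 -> G) -> V) : Prop :=
  equivariant f /\ cobord f = 0.

Definition is_coboundary (n : nat) : (('I_n.+1 -> G) -> V) -> Prop :=
  if n is m.+1 then fun f => exists2 h, equivariant h & f = cobord h
  else fun f => f = 0.

Definition cocycle_pred (n : nat) : {pred ('I_n.+1 -> G) -> V} :=
  fun f => `[< is_cocycle f >].

Fact equivariant_submod n a (f h : ('I_n -> G) -> V) :
  equivariant f -> equivariant h -> equivariant (a *: f + h).
Proof.
move=> Ef Eh g x.
by rewrite -[LHS]/(a *: f _ + h _) Ef Eh -[in RHS]/(a *: f x + h x) gact_linear.
Qed.

Fact equivariant0 n : equivariant (0 : ('I_n -> G) -> V).
Proof.
move=> g x; rewrite -[LHS]/(0 : V) -[in RHS]/(0 : V).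
have /eqP := gact_linear M g 1 0 0.
by rewrite !scale1r addr0 -[X in X == _]addr0 (inj_eq (addrI _)) => /eqP.
Qed.

Fact cobord_linear n : linear (@cobord n).
Proof.
move=> a f h; apply/funext => x; rewrite -[RHS]/(a *: cobord f x + cobord h x).
rewrite /cobord scaler_sumr -big_split; apply: eq_bigr => j _ /=.
by rewrite -[in LHS]/(a *: f _ + h _) scalerDr !scalerA mulrC.
Qed.

Fact cobord0 n : @cobord n 0 = 0.
Proof.
by apply/funext => x; rewrite /cobord big1 // => j _; exact: scaler0.
Qed.

Fact cobord_cobord n (f : ('I_n.+1 -> G) -> V) : cobord (cobord f) = 0.
Proof.
apply/funext => x; rewrite /cobord.
under eq_bigr do rewrite scaler_sumr.
pose sw (p : 'I_n.+3 * 'I_n.+2) : 'I_n.+3 * 'I_n.+2 :=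
  (lift p.1 p.2, inord (if (p.2 < p.1)%N then p.1.-1 else p.1)).
have swE1 p : (sw p).1 = bump p.1 p.2 :> nat by [].
have swE2 p : (sw p).2 = (if (p.2 < p.1)%N then p.1.-1 else p.1) :> nat.
  rewrite inordK //; case: p => [[j /= jn] [i /= i_n]]; case: ifP; lia.
have swK p : sw (sw p) = p.
  rewrite [RHS]surjective_pairing [LHS]surjective_pairing.
  congr pair; apply: ord_inj.
    by rewrite swE1 swE2 swE1 /bump; case: p => [[j /= jn] [i /= i_n]]; case: ifP; lia.
  by rewrite !(swE1, swE2) /bump; case: p => [[j /= jn] [i /= i_n]]; repeat case: ifP; lia.
clearbody sw; rewrite pair_big /= (bigID (fun p : 'I_n.+3 * 'I_n.+2 => p.2 < p.1)%N) /=.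
rewrite [X in _ + X](reindex_onto sw sw) /=; last by move=> p _; exact: swK.
apply/eqP; rewrite addr_eq0 -sumrN; apply/eqP.
apply: eq_big => [p|[j i] /= ij].
  rewrite swK eqxx andbT !(swE1, swE2) /bump; case: p => [[j /= jn] [i /= i_n]]; case: ifP; lia.
rewrite !scalerA -!exprD -scaleNr; congr (_ *: f _).
  rewrite !(swE1, swE2) /= ij /bump leqNgt ij add0n -signr_odd -[in RHS]signr_odd !oddD.
  by case: j ij => -[|j] //= _ _; case: odd; case: odd; rewrite ?expr1 ?expr0 ?opprK.
apply/funext => k /=; congr x; apply: val_inj => /=.
rewrite !(swE1, swE2) /= ij /bump; case: j i k ij => [j /= jn] [i /= i_n] [k /= kn] ij; lia.
Qed.

Fact coboundary_cocycle n (f : ('I_n.+1 -> G) -> V) :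
  is_coboundary f -> is_cocycle f.
Proof.
case: n f => [f /= ->|n f /= [h Eh ->]].
  by split; [exact: equivariant0|exact: cobord0].
split; last exact: cobord_cobord.
move=> g x; rewrite /cobord.
have gD a v w : M g (a *: v + w) = a *: M g v + M g w by exact: gact_linear.
have g0 : M g 0 = 0 by have := @equivariant0 0 g (fun=> 1%g).
have -> : M g (\sum_(j < n.+2) (-1) ^+ j *: h (x \o lift j)) = \sum_(j < n.+2) M g ((-1) ^+ j *: h (x \o lift j)).
  by apply: (big_morph (M g)) => // v w; have := gD 1 v w; rewrite !scale1r.
apply: eq_bigr => j _; have := gD ((-1) ^+ j) (h (x \o lift j)) 0; rewrite g0 !addr0 => ->.
by congr (_ *: _); rewrite -Eh.
Qed.

Fact cocycle_submod n : GRing.submod_closed (@cocycle_pred n).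
Proof.
split; first by apply/asboolP; split; [exact: equivariant0 | exact: cobord0].
move=> a f h /asboolP[Ef df] /asboolP[Eh dh]; apply/asboolP; split.
  exact: equivariant_submod.
by rewrite cobord_linear df dh scaler0 addr0.
Qed.

HB.instance Definition _ n :=
  GRing.isSubmodClosed.Build K (('I_n.+1 -> G) -> V) (@cocycle_pred n)
    (cocycle_submod n).

Definition cocycle (n : nat) : Type :=
  {f : ('I_n.+1 -> G) -> V | @cocycle_pred n f}.

HB.instance Definition _ n := Choice.on (cocycle n).
HB.instance Definition _ n := SubType.on (cocycle n).
HB.instance Definition _ n :=
  GRing.SubChoice_isSubLmodule.Build K _ (@cocycle_pred n) (cocycle n)
    (cocycle_submod n).

Definition coboundary_pred (n : nat) : {pred cocycle n} :=
  fun z => `[< is_coboundary (val z) >].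

Fact val_cocycleP n a (f h : cocycle n) :
  val (a *: f + h) = a *: val f + val h.
Proof. exact: linearP. Qed.

Fact coboundary_submod n : GRing.submod_closed (@coboundary_pred n).
Proof.
case: n => [|n]; split.
- by apply/asboolP; rewrite /is_coboundary raddf0.
- move=> a f h /asboolP Ef /asboolP Eh; apply/asboolP.
  by rewrite val_cocycleP /is_coboundary Ef Eh scaler0 addr0.
- apply/asboolP; exists 0; first exact: equivariant0.
  by rewrite raddf0 cobord0.
move=> a f h /asboolP[f' Ef' Ef] /asboolP[h' Eh' Eh]; apply/asboolP.
exists (a *: f' + h'); first exact: equivariant_submod.
by rewrite val_cocycleP Ef Eh cobord_linear.
Qed.

Definition cohomology (n : nat) : lmodType K := lquot (@coboundary_submod n).

End Cohomology.

Section CharacteristicVarieties.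
Variables (R : realType) (G : groupType).

Definition character_torus : Type := UMagmaMorphism.type G (mul_group R[i]).

Definition trivial_character : character_torus := one_fun (mul_group R[i]).

Fact char_module_linear (rho : character_torus) (g : G) :
  linear (fun z : R[i]^o => (val (rho g) * z : R[i]^o)).
Proof. by move=> a y z; rewrite mulrDr /GRing.scale /= mulrCA. Qed.
Fact char_module1 (rho : character_torus) (z : R[i]^o) :
  val (rho 1%g) * z = z.
Proof. by rewrite gmulf1 mul1r. Qed.
Fact char_moduleM (rho : character_torus) (g h : G) (z : R[i]^o) :
  val (rho (g * h)%g) * z = val (rho g) * (val (rho h) * z).
Proof. by rewrite gmulfM /= mulrA. Qed.

Definition char_module (rho : character_torus) : gmodule G R[i]^o :=
  GModule (char_module_linear rho) (char_module1 rho) (char_moduleM rho).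

Definition trivial_module : gmodule G R[i]^o :=
  @GModule G R[i] R[i]^o (fun _ z => z) (fun _ _ _ _ => erefl) (fun _ => erefl)
    (fun _ _ _ => erefl).

Definition betti (i : nat) : \bar R := dimension R (cohomology trivial_module i).

Definition char_variety (i k : nat) : set character_torus :=
  [set rho | ((k%:R)%:E <= dimension R (cohomology (char_module rho) i))%E].

End CharacteristicVarieties.

Arguments trivial_character : clear implicits.
Arguments betti : clear implicits.
Arguments char_variety : clear implicits.

(* Main.v *)
(** Triviality of [rho] is detected by a single element [z] with [rho z != 1].
    Right translation by [z] is homotopic to the identity on homogeneous
    cochains, so conjugation by [z] acts on [H^n(G, C_rho)] as the scalar
    [rho z^-1], which is not [1].  On the other hand this action is unipotent,
    whence [H^n(G, C_rho) = 0].  Unipotency is proved for every term of the lower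
    central series, from the trivial group upwards: as [z] acts trivially on
    [gamma_k / gamma_(k+1)], it acts on the columns of the Hochschild-Serre
    double complex of [gamma_(k+1)] in [gamma_k] through its action on the
    cohomology of [gamma_(k+1)], and the Alexander-Whitney map brings the
    conclusion back from the total complex to [gamma_k]. *)

Require Import Defs.
From mathcomp Require Import all_boot all_order all_algebra.
From mathcomp Require Import all_classical all_reals.
From mathcomp Require Import constructive_ereal ereal complex ring.

Set Implicit Arguments.
Unset Strict Implicit.
Unset Printing Implicit Defensive.

Import Order.TTheory GRing.Theory Num.Theory.

Local Open Scope classical_set_scope.
Local Open Scope ring_scope.

(** * Homogeneous cochains on sequences *)

Section SequenceCochains.
Variables (K : fieldType) (A : Type).
Implicit Types (f g : seq A -> K) (s t : seq A).

(* A homogeneous [n]-cochain is a function on the sequences of size [n.+1], and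
   [diff] is the alternating sum of the deletions.  The augmented degree (size
   [0]) is discarded by requiring [f [::] = 0]. *)
Fixpoint diff f s : K :=
  if s is x :: t then f t - diff (fun u => f (x :: u)) t else 0.

Lemma eq_diff f g s :
  (forall t, (size t).+1 = size s -> f t = g t) -> diff f s = diff g s.
Proof.
elim: s f g => [//|x s IH] f g fg /=; rewrite fg //; congr (_ - _).
by apply: IH => t ts; apply: fg; rewrite /= ts.
Qed.

Lemma diff_lin a f g s :
  diff (fun t => a * f t + g t) s = a * diff f s + diff g s.
Proof.
by elim: s f g => [|x s IH] f g /=; rewrite ?mulr0 ?addr0 // IH; ring.
Qed.

Lemma diffB f g s : diff (fun t => f t - g t) s = diff f s - diff g s.
Proof.
rewrite -[RHS]addrC -mulN1r -diff_lin.
by apply: eq_diff => t _; rewrite mulN1r addrC.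
Qed.

Lemma diff0 s : diff (fun=> 0) s = 0.
Proof. by elim: s => //= x s ->; rewrite subr0. Qed.

Lemma diffZ a f s : diff (fun t => a * f t) s = a * diff f s.
Proof.
rewrite -[RHS]addr0 -(diff0 s) -diff_lin.
by apply: eq_diff => t _; rewrite addr0.
Qed.

Lemma diff_diff f s : diff (diff f) s = 0.
Proof.
elim: s f => //= x s IH f; rewrite (diffB f) IH; ring.
Qed.

End SequenceCochains.

Lemma diff_map (K : fieldType) (A B : Type) (phi : A -> B) (f : seq B -> K) s :
  diff f (map phi s) = diff (f \o map phi) s.
Proof. by elim: s f => //= x s IH f; rewrite IH. Qed.

(** * The prism homotopy between the identity and a self-map *)

Section Prism.
Variables (K : fieldType) (A : Type) (phi : A -> A).
Implicit Types (f : seq A -> K).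

(** The alternating sum over [i] of [f [:: x_0; ...; x_i; phi x_i; ...; phi x_n]]. *)
Fixpoint prism f s : K :=
  if s is x :: t then
    f (x :: phi x :: map phi t) - prism (fun u => f (x :: u)) t
  else 0.

Lemma prismB f g s : prism (fun t => f t - g t) s = prism f s - prism g s.
Proof.
by elim: s f g => [|x s IH] f g /=; rewrite ?subr0 // IH; ring.
Qed.

Lemma eq_prism f g s :
  (forall t, size t = (size s).+1 -> f t = g t) -> prism f s = prism g s.
Proof.
elim: s f g => [//|x s IH] f g fg /=; rewrite fg /= ?size_map //.
by congr (_ - _); apply: IH => t ts; apply: fg; rewrite /= ts.
Qed.

Lemma prism_homotopy f s :
  diff (prism f) s + prism (diff f) s = f (map phi s) - f s.
Proof.
elim: s f => [|x s IH] f /=; first by rewrite addr0 subrr.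
rewrite prismB diffB.
have -> : diff (fun u => f (x :: phi x :: map phi u)) s
    = diff (fun u => f (x :: phi x :: u)) (map phi s) by rewrite diff_map.
by have /(canRL (addrK _)) /= -> := IH (fun t => f (x :: t)); ring.
Qed.

Lemma prismZ a f s : prism (fun t => a * f t) s = a * prism f s.
Proof. by elim: s f => [|x s IH] f /=; rewrite ?mulr0 // IH mulrBr. Qed.

Lemma prism_map (L : A -> A) f s : (forall x, phi (L x) = L (phi x)) ->
  prism f (map L s) = prism (f \o map L) s.
Proof.
move=> phiL; elim: s f => //= x s IH f; rewrite IH phiL -!map_comp.
by rewrite (eq_map phiL).
Qed.

End Prism.

(** * Total differential of a double complex *)

Section DoubleComplex.
Variables (K : fieldType) (A B : Type).
Implicit Types (f g : seq A -> seq B -> K) (xs : seq A) (ys : seq B).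

(* The total differential; its [ys]-part has sign [(-1) ^+ size xs]. *)
Fixpoint tdiff f xs ys : K :=
  if xs is x :: xs' then f xs' ys - tdiff (fun u => f (x :: u)) xs' ys
  else diff (f [::]) ys.

Lemma eq_tdiff f g xs ys :
  (forall us vs, (size us + size vs).+1 = (size xs + size ys)%N ->
    f us vs = g us vs) ->
  tdiff f xs ys = tdiff g xs ys.
Proof.
elim: xs f g => [|x xs IH] f g fg /=.
  by apply: eq_diff => t ts; apply: fg.
rewrite fg //; congr (_ - _).
by apply: IH => us vs uv; apply: fg; rewrite /= addSn uv.
Qed.

Lemma tdiff_lin a f g xs ys :
  tdiff (fun us vs => a * f us vs + g us vs) xs ys
    = a * tdiff f xs ys + tdiff g xs ys.
Proof.
by elim: xs f g => [|x xs IH] f g /=; rewrite ?diff_lin // IH; ring.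
Qed.

Lemma tdiffB f g xs ys :
  tdiff (fun us vs => f us vs - g us vs) xs ys = tdiff f xs ys - tdiff g xs ys.
Proof.
rewrite -[RHS]addrC -mulN1r -tdiff_lin.
by apply: eq_tdiff => us vs _; rewrite mulN1r addrC.
Qed.

Lemma tdiffZ a f xs ys :
  tdiff (fun us vs => a * f us vs) xs ys = a * tdiff f xs ys.
Proof. by elim: xs f => [|x xs IH] f /=; rewrite ?diffZ // IH mulrBr. Qed.

Lemma tdiff0 xs ys : tdiff (fun _ _ => 0) xs ys = 0.
Proof. by elim: xs => [|x xs /= ->]; rewrite /= ?diff0 ?subr0. Qed.

Lemma tdiff_tdiff f xs ys : tdiff (tdiff f) xs ys = 0.
Proof.
elim: xs f => [|x xs IH] f /=; first exact: diff_diff.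
by rewrite tdiffB IH; ring.
Qed.

(** The [xs]-part of [tdiff] evaluates [f] only at shorter [us], where it vanishes; the signed
    [ys]-part is what remains. *)
Lemma tdiff_lead f xs ys :
  (forall us vs, (size us < size xs)%N ->
     (size us + size vs).+1 = (size xs + size ys)%N -> f us vs = 0) ->
  tdiff f xs ys = (-1) ^+ size xs * diff (f xs) ys.
Proof.
elim: xs f => [|x xs IH] f f0 /=; first by rewrite mul1r.
rewrite f0 //= IH ?exprS ?sub0r ?mulN1r ?mulNr // => us vs usx usvs.
by apply: f0; rewrite //= addSn usvs.
Qed.

(** Deleting an entry commutes with [map q]. With [q] a coset map, cochains on [G / H] are thus
    stable under [tdiff]. *)
Lemma tdiff_cong (T : Type) (q : A -> T) f xs xs' ys :
  (forall us us' vs, map q us = map q us' -> f us vs = f us' vs) ->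
  map q xs = map q xs' -> tdiff f xs ys = tdiff f xs' ys.
Proof.
elim: xs xs' f => [|x xs IH] [|x' xs'] f //= fq [qx qxs].
rewrite (fq xs xs') // -(IH xs') //; last first.
  by move=> us us' vs quu; apply: fq; rewrite /= quu.
congr (_ - _); apply: eq_tdiff => us vs _.
by apply: fq; rewrite /= qx.
Qed.

End DoubleComplex.

Lemma tdiff_map (K : fieldType) (A A' B B' : Type) (phi : A -> A')
    (psi : B -> B') (f : seq A' -> seq B' -> K) xs ys :
  tdiff f (map phi xs) (map psi ys)
    = tdiff (fun us vs => f (map phi us) (map psi vs)) xs ys.
Proof.
by elim: xs f => [|x xs IH] f /=; [rewrite diff_map | rewrite IH].
Qed.

(** * The Alexander-Whitney map *)

Section AlexanderWhitney.
Variables (K : fieldType) (A : Type).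
Implicit Types (f g : seq A -> seq A -> K) (s : seq A).

(* Up to signs, the sum over [p] of [f [:: y_0; ...; y_p] [:: y_p; ...; y_q]]. *)
Fixpoint aw f s : K :=
  if s is y :: t then f [:: y] (y :: t) - aw (fun us => f (y :: us)) t else 0.

Lemma eq_aw f g s :
  (forall us vs, (size us + size vs)%N = (size s).+1 -> f us vs = g us vs) ->
  aw f s = aw g s.
Proof.
elim: s f g => [//|y s IH] f g fg /=; rewrite fg //; congr (_ - _).
by apply: IH => us vs uv; apply: fg; rewrite /= addSn uv.
Qed.

Lemma awB f g s : aw (fun us vs => f us vs - g us vs) s = aw f s - aw g s.
Proof.
by elim: s f g => [|x s IH] f g /=; rewrite ?subr0 // IH; ring.
Qed.

Lemma awZ a f s : aw (fun us vs => a * f us vs) s = a * aw f s.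
Proof. by elim: s f => [|x s IH] f /=; rewrite ?mulr0 // IH mulrBr. Qed.

Lemma aw0 s : aw (fun _ _ => 0) s = 0.
Proof. by elim: s => [|x s /= ->]; rewrite ?subr0. Qed.

Lemma aw_nil f s : (forall x us vs, f (x :: us) vs = 0) -> aw f s = 0.
Proof.
move=> f0; case: s => //= y t; rewrite f0 sub0r -[X in - X = _](_ : 0 = _) ?oppr0 //.
by rewrite -(aw0 t); apply: eq_aw => us vs _; rewrite f0.
Qed.

Lemma aw_map (L : A -> A) f s :
  aw f (map L s) = aw (fun us vs => f (map L us) (map L vs)) s.
Proof. by elim: s f => //= x s IH f; rewrite IH. Qed.

(** Deleting the repeated entry [y_p] on the right in one term and [y_(p+1)] on the left in the next
    gives the same value with opposite signs. After this telescoping only the two ends [f [::] s]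
    and [f s [::]] are left. *)
Lemma aw_tdiff f s : (forall us, f us [::] = 0) ->
  aw (tdiff f) s + diff (aw f) s = f [::] s.
Proof.
elim: s f => [|y s IH] f f0 /=; first by rewrite f0 addr0.
rewrite awB diffB.
have /(canRL (addrK _)) /= -> := IH (fun us => f (y :: us)) (fun us => f0 _).
by ring.
Qed.

End AlexanderWhitney.

(** * Conjugation by [z] on cochains, and the trivial group *)

Lemma conj_mulR (G : groupType) (x y : G) : (x ^ y = x * [~ x, y])%g.
Proof. by rewrite /commg mulVKg. Qed.

Section Twist.
Variables (G : groupType) (K : fieldType) (rho : G -> K) (z : G).
Hypothesis rho1 : rho 1%g = 1.
Hypothesis rhoM : forall x y, rho (x * y)%g = rho x * rho y.
Implicit Types (f : seq G -> K) (F : seq G -> seq G -> K) (H : set G).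

Let lmul (g : G) : seq G -> seq G := map (fun x => g * x)%g.
Let conjz : seq G -> seq G := map (fun x => x ^ z)%g.

Definition twist f s := f (conjz s) - f s.

Definition semi_invariant H f :=
  forall g s, H g -> f (lmul g s) = rho g * f s.

(* Conjugation by [z] is unipotent on [H^(n-1)(H, K_rho)], which is computed
   from the [H]-equivariant cochains on [G]. *)
Definition unipotent_twist H n := exists m, forall f,
  semi_invariant H f -> f [::] = 0 ->
  (forall s, size s = n.+1 -> diff f s = 0) ->
  exists h, [/\ semi_invariant H h, h [::] = 0 &
    forall s, size s = n -> iter m twist f s = diff h s].

Lemma rhoV x : rho x * rho x^-1%g = 1.
Proof. by rewrite -rhoM mulgV rho1. Qed.

Lemma rhoJ x : rho (x ^ z)%g = rho x.
Proof. by rewrite /conjg !rhoM mulrCA mulrA -mulrA [_ * rho z]mulrC rhoV mulr1. Qed.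

Lemma lmulK g : cancel (lmul g^-1%g) (lmul g).
Proof.
by move=> s; rewrite /lmul -map_comp map_id_in // => x _ /=; rewrite mulVKg.
Qed.

Lemma lmulVK g : cancel (lmul g) (lmul g^-1%g).
Proof.
by move=> s; rewrite /lmul -map_comp map_id_in // => x _ /=; rewrite mulKg.
Qed.

Lemma lmulM g k s : lmul (g * k)%g s = lmul g (lmul k s).
Proof. by rewrite /lmul -map_comp; apply: eq_map => x /=; rewrite mulgA. Qed.

Lemma conjz_lmul g s : conjz (lmul g s) = lmul (g ^ z)%g (conjz s).
Proof. by rewrite /conjz /lmul -!map_comp; apply: eq_map => x /=; rewrite conjMg. Qed.

Lemma eq_twist n f g : (forall s, size s = n -> f s = g s) ->
  forall s, size s = n -> twist f s = twist g s.
Proof. by move=> fg s sn; rewrite /twist !fg // size_map. Qed.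

Lemma eq_iter_twist n m f g : (forall s, size s = n -> f s = g s) ->
  forall s, size s = n -> iter m twist f s = iter m twist g s.
Proof. by move=> fg; elim: m => //= m IH s sn; apply: eq_twist sn. Qed.

Lemma iter_twist_lin m a f g s :
  iter m twist (fun t => a * f t + g t) s
    = a * iter m twist f s + iter m twist g s.
Proof. by elim: m s => //= m IH s; rewrite {1}/twist !IH /twist; ring. Qed.

Lemma iter_twist0 m s : iter m twist (fun=> 0) s = 0.
Proof. by elim: m s => //= m IH s; rewrite /twist !IH subr0. Qed.

Lemma diff_iter_twist m f s :
  diff (iter m twist f) s = iter m twist (diff f) s.
Proof.
elim: m s => //= m IH s; rewrite [RHS]/twist -!IH /conjz diff_map -diffB.
exact: eq_diff.
Qed.

Lemma iter_twist_nil m f : f [::] = 0 -> iter m twist f [::] = 0.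
Proof. by move=> f0; elim: m => //= m IH; rewrite /twist /= IH subr0. Qed.

Lemma tdiff_iter_twist m F xs ys :
  tdiff (fun us => iter m twist (F us)) xs ys = iter m twist (tdiff F xs) ys.
Proof.
elim: xs F ys => [|x xs IH] F ys /=; first exact: diff_iter_twist.
rewrite IH.
rewrite -[RHS](_ : iter m twist
    (fun t => -1 * tdiff (fun u => F (x :: u)) xs t + F xs t) ys = _).
  by rewrite iter_twist_lin mulN1r addrC.
by apply: (@eq_iter_twist (size ys)) => // t _; rewrite mulN1r addrC.
Qed.

Lemma semi_invariant_iter_twist H m f : (forall g, H g -> H (g ^ z)%g) ->
  semi_invariant H f -> semi_invariant H (iter m twist f).
Proof.
move=> HJ Hf; elim: m => //= m IH g s Hg.
by rewrite /twist conjz_lmul !IH ?rhoJ ?mulrBr //; apply: HJ.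
Qed.

(** Prepending [1] contracts the augmented complex. One twist is spent on degree zero: it makes the
    primitive vanish at [[::]], because [1 ^ z = 1]. *)
Lemma unipotent_twist1 n : unipotent_twist [set 1%g] n.
Proof.
exists 1%N => f _ f0 df0; exists (fun s => twist f (1%g :: s)); split.
- by move=> g s ->; rewrite rho1 mul1r /lmul (eq_map mul1g) map_id.
- by rewrite /twist /= conj1g subrr.
move=> [|x s] sn; first by rewrite /= /twist /= subrr.
have : diff (iter 1 twist f) (1%g :: x :: s) = 0.
  by rewrite diff_iter_twist -[LHS]/(diff f _ - diff f _) !df0 ?subrr -?sn //= size_map.
by move=> /eqP; rewrite subr_eq0 => /eqP.
Qed.

(** * The Hochschild-Serre step from [H] to [H'] *)

Section Step.
Variables H H' : set G.
Hypothesis subH : is_subgroup H.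
Hypothesis subH' : is_subgroup H'.
Hypothesis HJ : forall g x, H g -> H (g ^ x)%g.
Hypothesis HH' : H `<=` H'.
Hypothesis H'z : forall g, H' g -> H [~ g, z]%g.

Let coset (x : G) : set G := [set y | H (x^-1 * y)%g].

Let cosetP x y : H (x^-1 * y)%g -> coset x = coset y.
Proof.
have [_ HM HV] := subH.
move=> Hxy; apply/seteqP; split => w; rewrite /coset /= => Hw.
  have -> : (y^-1 * w = (x^-1 * y)^-1 * (x^-1 * w))%g.
    by rewrite invgM invgK -mulgA mulVKg.
  by apply: HM => //; apply: HV.
have -> : (x^-1 * w = (x^-1 * y) * (y^-1 * w))%g by rewrite -mulgA mulVKg.
exact: HM.
Qed.

Let map_coset_lmul g us us' :
  map coset us = map coset us' -> map coset (lmul g us) = map coset (lmul g us').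
Proof.
pose L (C : set G) : set G := [set y | C (g^-1 * y)%g].
have E vs : map coset (lmul g vs) = map L (map coset vs).
  rewrite /lmul -!map_comp; apply: eq_map => x /=.
  by apply/funext => y; rewrite /coset /L /= invgM mulgA.
by move=> e; rewrite !E e.
Qed.

(** By normality [h * x = x * h ^ x] lies in the coset of [x], so left translation by [H] is trivial
    on [G / H]. *)
Let map_coset_lmulH g h us : H h ->
  map coset (lmul (g * h)%g us) = map coset (lmul g us).
Proof.
move=> Hh; rewrite lmulM; apply: map_coset_lmul.
rewrite /lmul -map_comp; apply: eq_map => x /=; apply: cosetP.
have [_ _ HV] := subH.
by rewrite invgM -mulgA; apply: HJ; apply: HV.
Qed.

(* The Hochschild-Serre double complex: the variables [xs] live in [G / H], which
   is encoded by invariance under right multiplication of each entry by [H]. *)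
Record bicochain F : Prop := Bicochain {
  bi_coset : forall us us' vs,
    map coset us = map coset us' -> F us vs = F us' vs;
  bi_inv : forall g us vs, H' g -> F (lmul g us) (lmul g vs) = rho g * F us vs;
  bi_nil_l : forall vs, F [::] vs = 0;
  bi_nil_r : forall us, F us [::] = 0 }.

Lemma bicochain_lin a F1 F2 : bicochain F1 -> bicochain F2 ->
  bicochain (fun us vs => a * F1 us vs + F2 us vs).
Proof.
move=> [c1 i1 l1 r1] [c2 i2 l2 r2]; split.
- by move=> us us' vs e; rewrite (c1 _ us') // (c2 _ us').
- by move=> g us vs Hg; rewrite i1 // i2 //; ring.
- by move=> vs; rewrite l1 l2 mulr0 addr0.
- by move=> us; rewrite r1 r2 mulr0 addr0.
Qed.

Lemma bicochain_tdiff F : bicochain F -> bicochain (tdiff F).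
Proof.
move=> [c i l r]; split.
- by move=> us us' vs; apply: tdiff_cong.
- move=> g us vs Hg; rewrite tdiff_map -tdiffZ; apply: eq_tdiff => us' vs' _.
  exact: i.
- by move=> vs /=; rewrite -[RHS](diff0 K vs); apply: eq_diff => t _.
- move=> us; elim: us F r {c i l} => //= x us IH F r.
  by rewrite r IH ?subr0.
Qed.

Let H'J g : H' g -> H' (g ^ z)%g.
Proof.
have [_ HM' _] := subH'.
by move=> H'g; rewrite conj_mulR; apply: HM' => //; apply/HH'/H'z.
Qed.

(** Only the second variable is conjugated, which replaces [g] by [g ^ z = g * [~ g, z]] there.
    Since the commutator lies in [H], both elements act alike on the first variable, and invariance
    under [H'] survives. *)
Lemma bicochain_iter_twist m F : bicochain F ->
  bicochain (fun us => iter m twist (F us)).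
Proof.
move=> bF; elim: m => //= m [c i l r]; split.
- by move=> us us' vs e; rewrite /twist !(c us us').
- move=> g us vs H'g; rewrite /twist i // conjz_lmul.
  rewrite (c (lmul g us) (lmul (g ^ z)%g us)).
    by rewrite i ?rhoJ ?mulrBr //; exact: H'J.
  by rewrite conj_mulR map_coset_lmulH //; exact: H'z.
- by move=> vs; rewrite /twist !l subr0.
- by move=> us; rewrite /twist /= !r subr0.
Qed.

Lemma bicochain_semi_invariant F us : bicochain F -> semi_invariant H (F us).
Proof.
move=> bF g s Hg; rewrite -(bi_inv bF) //; [apply: (bi_coset bF)|exact: HH'].
by rewrite -[g]mul1g map_coset_lmulH // /lmul (eq_map (@mul1g G)) map_id.
Qed.

(** Each [x] is divided by a chosen representative of its coset [H' x]. *)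
Lemma equivariant_retraction : exists pi : G -> G,
  (forall x, H' (pi x)) /\ (forall g x, H' g -> pi (g * x)%g = (g * pi x)%g).
Proof.
have [H1 HM HV] := subH'.
pose C (x : G) : set G := [set w | H' (w * x^-1)%g].
have CM g x : H' g -> C (g * x)%g = C x.
  move=> Hg; apply/seteqP; split => w; rewrite /C /= invgM mulgA => Hw.
    by have := HM _ _ Hw Hg; rewrite mulgVK.
  by apply: HM => //; apply: HV.
exists (fun x => x * (xget 1%g (C x))^-1)%g; split => [x|g x Hg].
  rewrite -[(_ * _)%g]invgK invgM invgK; apply: HV.
  by apply: (@xgetPex _ 1%g (C x)); exists x; rewrite /C /= mulgV.
by rewrite CM // mulgA.
Qed.

(** Each [F us] is an [H]-cocycle, so a power of [twist] gives it a primitive. To make the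
    primitives [H']-invariant together, [us] is first moved by [(k us)^-1] to a normalised position,
    and the chosen primitive is transported back. *)
Lemma unipotent_twist_column n : unipotent_twist H n ->
  exists m, forall p F, bicochain F ->
  (forall us vs, size us = p.+1 -> size vs = n.+1 -> diff (F us) vs = 0) ->
  exists h, [/\ bicochain h, forall us vs, size us <> p.+1 -> h us vs = 0 &
    forall us vs, size us = p.+1 -> size vs = n ->
      iter m twist (F us) vs = diff (h us) vs].
Proof.
move=> [m Hm]; exists m => p F bF dF.
have [pi [piH piM]] := equivariant_retraction.
(* The primitive is chosen as a function of the cochain, not of [us], so that it depends on [us]
   only through cosets. *)
have /choice[Phi PhiP] : forall f, exists h, semi_invariant H f -> f [::] = 0 ->
    (forall s, size s = n.+1 -> diff f s = 0) ->
    [/\ semi_invariant H h, h [::] = 0 &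
      forall s, size s = n -> iter m twist f s = diff h s].
  move=> f; have [[h hP]|nh] := pselect (exists h, [/\ semi_invariant H h, h [::] = 0 &
      forall s, size s = n -> iter m twist f s = diff h s]); first by exists h.
  by exists f => fH f0 df; case: nh; exact: Hm.
have PhiF us : size us = p.+1 -> [/\ semi_invariant H (Phi (F us)), Phi (F us) [::] = 0 &
      forall s, size s = n -> iter m twist (F us) s = diff (Phi (F us)) s].
  move=> up; apply: PhiP; [exact: bicochain_semi_invariant|exact: bi_nil_r|].
  by move=> s sn; exact: dF.
pose k us := pi (head 1%g us).
have size_lmul_k us : size us = p.+1 -> size (lmul (k us)^-1%g us) = p.+1.
  by rewrite size_map.
have kM g us : H' g -> (0 < size us)%N -> k (lmul g us) = (g * k us)%g.
  by case: us => // x us H'g _; rewrite /k /= piM.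
pose h us vs := if size us == p.+1 then
    rho (k us) * Phi (F (lmul (k us)^-1%g us)) (lmul (k us)^-1%g vs) else 0.
exists h; split; [|by move=> us vs /eqP/negPf up; rewrite /h up|]; last first.
- move=> us vs up vn.
  have bFm := bicochain_iter_twist m bF.
  rewrite -[in LHS](lmulK (k us) us) -[in LHS](lmulK (k us) vs) (bi_inv bFm); last exact: piH.
  have [_ _ ->] := PhiF _ (size_lmul_k us up); last by rewrite size_map.
  rewrite diff_map -diffZ; apply: eq_diff => t _.
  by rewrite /h up eqxx.
- split.
  + move=> us us' vs e; rewrite /h -(size_map coset us) e size_map.
    case: eqP => // up'.
    have up : size us = p.+1 by rewrite -(size_map coset us) e size_map.
    (* Moving [us] within its cosets changes [k us] by a right factor in the normal subgroup [H];
       [rho g] then cancels against the semi-invariance of the primitive. *)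
    have [g Hg ->] : exists2 g, H g & k us' = (k us * g)%g.
      case: us us' e up up' => [|x us] [|x' us'] //= [ex _] _ _.
      have Hx : H (x^-1 * x')%g by rewrite -[H _]/(coset x x') ex /coset /= mulVg; case: subH.
      pose g := ((x^-1 * x') ^ x^-1)%g.
      exists (g ^ k (x :: us))%g; first by apply/HJ/HJ.
      rewrite -conjgC /k /= -piM; last exact/HH'/HJ.
      by rewrite /g conjgE invgK -!mulgA mulVg mulg1 mulVKg.
    rewrite invgM lmulM [in RHS]lmulM.
    have [Ih _ _] := PhiF _ (size_lmul_k us up).
    have [_ HM HV] := subH.
    have -> : F (lmul g^-1%g (lmul (k us)^-1%g us')) = F (lmul (k us)^-1%g us).
      apply/funext => t; apply: (bi_coset bF).
      rewrite -lmulM conjgC map_coset_lmulH; last exact/HJ/HV.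
      exact: map_coset_lmul.
    rewrite (Ih g^-1%g); last exact: HV.
    by rewrite rhoM mulrA -(mulrA (rho (k us))) rhoV mulr1.
  + move=> g us vs H'g; rewrite /h size_map; case: eqP => [up|]; last by rewrite mulr0.
    by rewrite kM ?up // rhoM invgM -mulrA !lmulM !lmulVK.
  + by move=> vs.
  move=> us; rewrite /h; case: eqP => // up.
  by have [_ -> _] := PhiF _ (size_lmul_k us up); rewrite mulr0.
Qed.

(* [p] is the filtration degree: the component of [F] of lowest degree [p.+1] in
   [xs] is a column cocycle, so a power of [twist] pushes [F] one step up. *)
Lemma bicochain_unipotent n : (forall k, unipotent_twist H k) ->
  forall j p, (p + j = n.+1)%N -> exists m, forall F, bicochain F ->
  (forall us vs, (size us + size vs = n.+2)%N -> tdiff F us vs = 0) ->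
  (forall us vs, (size us <= p)%N -> (size us + size vs = n.+1)%N ->
     F us vs = 0) ->
  exists h, bicochain h /\ forall us vs, (size us + size vs = n.+1)%N ->
    iter m twist (F us) vs = tdiff h us vs.
Proof.
move=> uH; elim=> [|j IH] p pj.
  (* Here [p = n.+1] bounds the size of every [us], so [F] is already zero in this total degree. *)
  exists 0%N => F bF _ F0; exists (fun _ _ => 0); split=> [|us vs uv].
    by split=> // *; rewrite mulr0.
  by rewrite tdiff0 /= F0 // -(addn0 p) pj -uv leq_addr.
have [m1 Hm1] := unipotent_twist_column (uH j).
have [m2 Hm2] := IH p.+1 (etrans (addSnnS p j) pj).
exists (m2 + m1)%N => F bF dF F0.
have [us vs up vj|h1 [bh1 h1p Fh1]] := Hm1 p F bF.
  have uv : (size us + size vs = n.+2)%N by rewrite up vj -pj addSn.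
  have /eqP := dF us vs uv; rewrite tdiff_lead; first by rewrite mulf_eq0 signr_eq0 => /eqP.
  move=> us' vs' uu' uv'; apply: F0; first by rewrite -ltnS -up.
  by apply: succn_inj; rewrite uv'.
(* The sign cancels the one in [tdiff_lead]; [+ 0] gives the shape of [bicochain_lin]. *)
pose h1' us vs := (-1) ^+ p.+1 * h1 us vs + 0.
have bh1' : bicochain h1'.
  by apply: bicochain_lin => //; split=> // *; rewrite mulr0.
(* Still a total cocycle, [F1] now also vanishes on [us] of size [p.+1], as the induction
   requires. *)
pose F1 us vs := -1 * tdiff h1' us vs + iter m1 twist (F us) vs.
have bF1 : bicochain F1.
  by apply: bicochain_lin; [exact: bicochain_tdiff|exact: bicochain_iter_twist].
have h1'E us vs : (size us <= p.+1)%N -> (size us + size vs = n.+1)%N ->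
    tdiff h1' us vs = iter m1 twist (F us) vs.
  move=> up uv; rewrite tdiff_lead; last first.
    move=> us' vs' uu' _; rewrite /h1' h1p ?mulr0 ?addr0 // => u'p.
    by move: (leq_trans uu' up); rewrite u'p ltnn.
  have [up'|/eqP up'] := eqVneq (size us) p.+1; last first.
    rewrite -[LHS](_ : (-1) ^+ size us * diff (fun=> 0) vs = _); last first.
      by congr (_ * _); apply: eq_diff => t _; rewrite /h1' h1p // mulr0 addr0.
    rewrite diff0 mulr0 -(iter_twist0 m1 vs).
    apply: (@eq_iter_twist (size vs)) => // t tv.
    by rewrite F0 ?tv // -ltnS ltn_neqAle up; apply/andP; split=> //; apply/eqP.
  rewrite Fh1 //; last by apply/eqP; rewrite -(eqn_add2l p.+1) -{1}up' uv -pj addSnnS.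
  rewrite up' -[RHS](signrMK p.+1); congr (_ * _).
  by rewrite -diffZ; apply: eq_diff => t _; rewrite /h1' addr0.
have [us vs uv|us vs up uv|h2 [bh2 Fh2]] := Hm2 F1 bF1.
- rewrite tdiff_lin tdiff_tdiff mulr0 add0r tdiff_iter_twist -(iter_twist0 m1 vs).
  by apply: (@eq_iter_twist (size vs)) => // t tv; rewrite dF // tv.
- by rewrite /F1 h1'E // mulN1r addNr.
(* Since [twist] commutes with [tdiff], twisting the subtracted coboundary gives the coboundary of
   the twisted [h1']. *)
exists (fun us vs => 1 * iter m2 twist (h1' us) vs + h2 us vs); split.
  by apply: bicochain_lin => //; exact: bicochain_iter_twist.
move=> us vs uv; rewrite tdiff_lin tdiff_iter_twist mul1r -Fh2 // iterD.
rewrite /F1 iter_twist_lin mulN1r addrA addrN add0r.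
by apply: (@eq_iter_twist (size vs)).
Qed.

(** A cocycle [f] enters the double complex as a total cocycle supported on singletons [us] and
    constant in them. As [aw] recovers [f] from it, [aw] of a total primitive is a primitive up to
    sign. *)
Lemma unipotent_twist_step n :
  (forall k, unipotent_twist H k) -> unipotent_twist H' n.
Proof.
move=> uH; have [m Hm] := bicochain_unipotent uH (add0n n.+1).
exists m => f fH' f0 df.
pose F (us vs : seq G) : K := if us is [:: _] then f vs else 0.
have bF : bicochain F.
  split=> [us us' vs|g us vs H'g||].
  - by case: us us' => [|x [|y us]] [|x' [|y' us']].
  - by case: us => [|x [|y us]] /=; rewrite ?mulr0 // fH'.
  - by [].
  - by case=> [|x [|y us]].
have [us vs uv|us vs|h [bh Fh]] := Hm F bF.
- case: us uv => [|x [|y us]] uv /=.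
  + exact: diff0.
  + by rewrite sub0r df ?oppr0 //; case: uv.
  + by rewrite tdiff0 subr0; case: us {uv} => [|y' us]; rewrite subrr.
- by case: us.
(* By [aw_tdiff], [aw] anticommutes with the differentials, whence the sign. *)
exists (fun s => -1 * aw h s); split.
- move=> g s H'g; rewrite mulrCA; congr (_ * _); rewrite aw_map -awZ.
  by apply: eq_aw => us vs _; exact: bi_inv.
- by rewrite mulr0.
move=> s sn; rewrite diffZ.
have := aw_tdiff s (bi_nil_r bh).
rewrite (bi_nil_l bh) => /eqP; rewrite addr_eq0 => /eqP dh.
(* [F] lives on singletons, so only the first term of [aw] survives. *)
have <- : aw (fun us => iter m twist (F us)) s = iter m twist f s.
  case: s {sn dh} => [|y t] /=; first by rewrite iter_twist_nil.
  rewrite aw_nil ?subr0 // => x us vs.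
  exact: iter_twist0.
rewrite mulN1r -dh; apply: eq_aw => us vs uv.
by rewrite Fh // uv sn.
Qed.

End Step.

(** * Conjugation as a scalar, and vanishing of the twisted cohomology *)

(** As [x ^ z = z^-1 * (x * z)], semi-invariance extracts [rho z^-1] and leaves a right translate,
    which [prism] compares with [f]. The homotopy stays semi-invariant because left and right
    translations commute. *)
Lemma iter_twist_eigen n f m :
  semi_invariant [set: G] f -> (forall s, size s = n.+1 -> diff f s = 0) ->
  exists h, [/\ semi_invariant [set: G] h, h [::] = 0 &
    forall s, size s = n ->
      iter m twist f s = (rho z^-1%g - 1) ^+ m * f s + diff h s].
Proof.
move=> fG df; elim: m => [|m [h [hG h0 Eh]]].
  exists (fun=> 0); split=> [g s _||s _]; rewrite ?mulr0 //.
  by rewrite diff0 mul1r addr0.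
pose phi x := (x * z)%g.
pose c := (rho z^-1%g - 1) ^+ m.
have phiM g x : phi (g * x)%g = (g * phi x)%g by rewrite /phi mulgA.
have Ef s : size s = n ->
    twist f s = (rho z^-1%g - 1) * f s + rho z^-1%g * diff (prism phi f) s.
  move=> sn; have := prism_homotopy phi f s.
  rewrite (@eq_prism _ _ _ (diff f) (fun=> 0)); last by move=> t ts; rewrite df ?ts ?sn.
  have -> : prism phi (fun=> 0 : K) s = 0 by elim: (s) => //= x t ->; rewrite subr0.
  have -> : twist f s = rho z^-1%g * f (map phi s) - f s.
    rewrite -fG //; congr (f _ - _); rewrite /lmul -map_comp.
    exact: eq_map.
  by rewrite addr0 => ->; ring.
exists (fun s => c * rho z^-1%g * prism phi f s + twist h s); split.
- move=> g s _; rewrite prism_map //.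
  have -> : prism phi (f \o lmul g) s = rho g * prism phi f s.
    by rewrite -prismZ; apply: eq_prism => t _; exact: fG.
  have /(_ g s I) /= -> : semi_invariant [set: G] (iter 1 twist h).
    exact: semi_invariant_iter_twist.
  by ring.
- by rewrite /= mulr0 add0r /twist /= subrr.
move=> s sn; rewrite iterS (eq_twist Eh) // diff_lin exprS -/c.
rewrite -[diff (twist h) s]/(diff (iter 1 twist h) s) diff_iter_twist.
transitivity (c * twist f s + twist (diff h) s); first by rewrite /twist; ring.
by rewrite Ef //=; ring.
Qed.

Lemma twisted_vanishing n f : rho z != 1 -> unipotent_twist [set: G] n ->
  semi_invariant [set: G] f -> (forall s, size s = n.+1 -> diff f s = 0) ->
  exists2 h, semi_invariant [set: G] h & forall s, size s = n -> f s = diff h s.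
Proof.
move=> rz [m Hm] fG df.
have r1 : rho z^-1%g - 1 != 0.
  rewrite subr_eq0; apply: contra_neq rz => e.
  by have := rhoV z; rewrite e mulr1.
(* [lmul z] fixes [[::]], so [f [::] = rho z * f [::]] with [rho z != 1]. *)
have f0 : f [::] = 0.
  have := fG z [::] I; rewrite /= => /eqP; rewrite -subr_eq0 -{1}(mul1r (f _)).
  by rewrite -mulrBl mulf_eq0 subr_eq0 eq_sym (negPf rz) => /eqP.
have [h1 [h1G _ E1]] := Hm f fG f0 df.
have [h2 [h2G _ E2]] := iter_twist_eigen m fG df.
(* The same iterate is both [diff h1] and [c * f + diff h2], and [c] is invertible. *)
pose c := (rho z^-1%g - 1) ^+ m.
exists (fun s => c^-1 * (h1 s - h2 s)) => [g s _|s sn].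
  by rewrite h1G // h2G //; ring.
by rewrite diffZ diffB -E1 // E2 // addrK mulKf // expf_neq0.
Qed.

End Twist.

(** * The lower central series and nilpotent groups *)

Section LowerCentralSeries.
Variable G : groupType.

Lemma is_subgroup_gen (A : set G) : is_subgroup (subgroup_gen A).
Proof.
split=> [B [[]]//|x y Ax Ay B [sB AB]|x Ax B [sB AB]].
  by case: (sB) => _ BM _; apply: BM; [exact: Ax|exact: Ay].
by case: (sB) => _ _ BV; apply: BV; exact: Ax.
Qed.

Lemma lower_central_subgroup n : is_subgroup (@lower_central_series G n).
Proof. by case: n => [|n]; [|exact: is_subgroup_gen]. Qed.

Lemma lower_central_commg n x y :
  @lower_central_series G n x -> @lower_central_series G n.+1 [~ x, y]%g.
Proof. by move=> nx; apply: sub_gen_smallest; exists x => //; exists y. Qed.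

Lemma lower_central_sub n :
  @lower_central_series G n.+1 `<=` @lower_central_series G n.
Proof.
elim: n => [|n IH] //; apply: smallest_sub; first exact: is_subgroup_gen.
by move=> _ [x /IH nx [y _ <-]]; exact: lower_central_commg.
Qed.

Lemma lower_central_conjg n x y :
  @lower_central_series G n x -> @lower_central_series G n (x ^ y)%g.
Proof.
move=> nx; have [_ nM _] := lower_central_subgroup n; rewrite conj_mulR.
by apply: nM => //; apply: lower_central_sub; exact: lower_central_commg.
Qed.

End LowerCentralSeries.

Lemma nilpotent_unipotent_twist (G : groupType) (K : fieldType) (rho : G -> K)
    (z : G) n : nilpotent_group G ->
  rho 1%g = 1 -> (forall x y, rho (x * y)%g = rho x * rho y) ->
  unipotent_twist rho z [set: G] n.
Proof.
move=> [c Gc] rho1 rhoM.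
suff: forall k, (k <= c)%N -> forall n,
    unipotent_twist rho z (@lower_central_series G (c - k)) n.
  by move=> /(_ c (leqnn c) n); rewrite subnn.
elim=> [|k IH] kc m; first by rewrite subn0 Gc; exact: unipotent_twist1.
have ck : (c - k = (c - k.+1).+1)%N by rewrite subnSK.
move: IH; rewrite ck => IH.
apply: (@unipotent_twist_step _ _ _ _ rho1 rhoM (@lower_central_series G (c - k.+1).+1)).
- exact: lower_central_subgroup.
- exact: lower_central_subgroup.
- by move=> g x; exact: lower_central_conjg.
- exact: lower_central_sub.
- by move=> g; exact: lower_central_commg.
- by move=> p; apply: IH; exact: ltnW.
Qed.

(** * Passage from sequences to the bar resolution *)

Lemma diff_sum (K : fieldType) (A : Type) (f : seq A -> K) s :
  diff f s = \sum_(j < size s) (-1) ^+ j * f (take j s ++ drop j.+1 s).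
Proof.
elim: s f => [|x s IH] f /=; first by rewrite big_ord0.
rewrite big_ord_recl /= drop0 mul1r IH -sumrN; congr (_ + _).
by apply: eq_bigr => j _; rewrite /bump /= exprS -mulrA mulN1r.
Qed.

Lemma nth_codom_ord (A : Type) (x0 : A) n (x : 'I_n -> A) (i : 'I_n) :
  nth x0 (codom x) i = x i.
Proof.
rewrite codomE (nth_map i) ?nth_ord_enum //.
by rewrite size_enum_ord.
Qed.

Lemma size_codom_ord (A : Type) n (x : 'I_n -> A) : size (codom x) = n.
Proof. by rewrite size_codom card_ord. Qed.

Lemma codom_nth (A : Type) (x0 : A) n s :
  size s = n -> codom (fun j : 'I_n => nth x0 s j) = s.
Proof.
move=> sn; apply: (@eq_from_nth _ x0) => [|i].
  by rewrite size_codom_ord.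
rewrite size_codom_ord => i_n.
by rewrite (nth_codom_ord _ _ (Ordinal i_n)).
Qed.

Lemma codom_lift (A : Type) n (x : 'I_n.+1 -> A) (j : 'I_n.+1) :
  codom (x \o lift j) = take j (codom x) ++ drop j.+1 (codom x).
Proof.
have sx := size_codom_ord x.
apply: (@eq_from_nth _ (x ord0)) => [|i].
  rewrite size_codom_ord size_cat size_takel ?size_drop sx; last exact: ltnW.
  by rewrite subSS subnKC // -ltnS.
rewrite size_codom_ord => i_n; rewrite (nth_codom_ord _ _ (Ordinal i_n)) /=.
rewrite -(nth_codom_ord (x ord0)) /= nth_cat size_takel ?sx; last exact/ltnW.
rewrite /bump ltnNge; case: leqP => ij; last by rewrite nth_take.
by rewrite nth_drop; congr nth; rewrite addSn subnKC.
Qed.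

Lemma cobord_codom (G : groupType) (K : fieldType) (h : seq G -> K) n
    (x : 'I_n.+2 -> G) :
  cobord (V := K^o) (fun y : 'I_n.+1 -> G => h (codom y)) x = diff h (codom x).
Proof.
rewrite diff_sum size_codom_ord; apply: eq_bigr => j _.
by rewrite codom_lift.
Qed.

Lemma char_cocycle_coboundary (R : realType) (G : groupType)
    (rho : character_torus R G) n (f : ('I_n.+2 -> G) -> R[i]^o) :
  nilpotent_group G -> rho <> trivial_character R G ->
  is_cocycle (char_module rho) f -> is_coboundary (char_module rho) f.
Proof.
move=> nilG rho_nt [Ef df].
pose r g : R[i] := val (rho g).
have r1 : r 1%g = 1 by rewrite /r gmulf1.
have rM x y : r (x * y)%g = r x * r y by rewrite /r gmulfM.
have [z rz] : exists z, r z != 1.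
  apply: contrapT => nz; apply: rho_nt.
  have : UMagmaMorphism.sort rho = one_fun (mul_group R[i]).
    apply/funext => g; apply/val_inj/eqP => /=.
    by apply/negPn/negP => rg; apply: nz; exists g.
  (* Equality of the underlying maps lifts to the bundled morphisms by proof irrelevance. *)
  case: rho {Ef df r r1 rM nz} => s [[s1] [sM]] /= es; subst s.
  rewrite /trivial_character.
  congr UMagmaMorphism.Pack.
  by congr (UMagmaMorphism.Class
    (Multiplicative_isUMagmaMorphism.Axioms_ _ _ _)
    (isMultiplicative.Axioms_ _ _ _)); exact: Prop_irrelevance.
(* Extension by zero to the other lengths; the default of [nth] is never reached. *)
pose F (s : seq G) : R[i] :=
  if size s == n.+2 then f (fun j => nth 1%g s j) else 0.
have FE y : F (codom y) = f y.
  rewrite /F size_codom_ord eqxx; congr f; apply/funext => j.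
  exact: nth_codom_ord.
have FG : semi_invariant r [set: G] F.
  move=> g s _; rewrite /F size_map; case: eqP => [sn|]; last by rewrite mulr0.
  rewrite -[RHS]/(char_module rho g _) -Ef; congr f; apply/funext => j.
  by rewrite (nth_map 1%g) ?sn.
have dF s : size s = n.+3 -> diff F s = 0.
  move=> sn; rewrite -(codom_nth 1%g sn) -cobord_codom.
  have -> : (fun y : 'I_n.+2 -> G => F (codom y)) = f by apply/funext.
  by rewrite df.
have [h hG Fh] := twisted_vanishing r1 rM rz
  (nilpotent_unipotent_twist z n.+2 nilG r1 rM) FG dF.
exists (fun y => h (codom y)) => [g x|].
  rewrite -[RHS]/(r g * h (codom x)) -hG //; congr h.
  by rewrite !codomE -map_comp.
apply/funext => x; rewrite -FE Fh ?size_codom_ord //.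
by rewrite -cobord_codom.
Qed.

(** * Dimension zero and the characteristic varieties *)

(** The quotient is a single point, so any nonempty family satisfies the relation with all
    coefficients [1]. *)
Lemma dimension_lquot_full (R : realType) (K : fieldType) (V : lmodType K)
    (W : {pred V}) (W_submod : GRing.submod_closed W) :
  (forall v, v \in W) -> (dimension R (lquot W_submod) <= 0)%E.
Proof.
move=> Wfull; apply: ge_ereal_sup => _ [[|n] [v v_indep] <-] //.
have lquot_eq (x y : lquot W_submod) : x = y.
  rewrite -(reprK x) -(reprK y); apply/eqP.
  by rewrite -(Quotient.idealrBE (submod_zmodClosed W_submod)) Wfull.
have := v_indep (fun=> 1) (lquot_eq _ _) ord0.
by move/eqP; rewrite oner_eq0.
Qed.

Lemma eq_gmodule (G : groupType) (K : fieldType) (V : lmodType K)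
    (M N : gmodule G V) : gact M = gact N -> M = N.
Proof.
case: M N => [a la a1 aM] [b lb b1 bM] /= ab; subst b.
by congr GModule; exact: Prop_irrelevance.
Qed.

Theorem theorem1p1 (R : realType) (G : groupType)
    (hfg : finitely_generated G) (hnil : nilpotent_group G)
    (i k : nat) (hi : (0 < i)%N) (hk : (0 < k)%N) :
  char_variety R G i k =
    if ((k%:R)%:E <= betti R G i)%E then [set trivial_character R G] else set0.
Proof.
have trivE : char_module (trivial_character R G) = trivial_module R G.
  by apply: eq_gmodule; apply/funext => g; apply/funext => v; exact: mul1r.
have only_triv rho : char_variety R G i k rho -> rho = trivial_character R G.
  case: i hi => // n _ k_le; apply: contrapT => rho_nt.
  (* For nontrivial [rho] every cocycle of positive degree is a coboundary, so the dimension is at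
     most [0], against [0 < k]. *)
  have : ((k%:R)%:E <= 0 :> \bar R)%E.
    apply: le_trans k_le _; apply: dimension_lquot_full => f.
    apply/asboolP; apply: char_cocycle_coboundary => //.
    exact/asboolP/(valP f).
  by rewrite lee_fin lern0 -leqn0 leqNgt hk.
apply/seteqP; split=> rho.
  move=> /[dup] /only_triv -> ; rewrite /char_variety /= trivE => ->.
  by [].
case: ifP => // k_le /= ->.
by rewrite /char_variety /= trivE.
Qed.
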